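(* For $\alpha>0$ and $\lambda>0$, let $X_{\alpha,\lambda}$ denote a Weibull random variable with probability density function $$f_{\alpha,\lambda}(x)=\alpha\lambda x^{\alpha-1}e^{-\lambda x^\alpha},\qquad x>0.$$ Then for every real $y>0$, $$\inf_{\alpha>0,\,\lambda>0}\mathbf{P}\left(|X_{\alpha,\lambda}-\mathbf{E}[X_{\alpha,\lambda}]|\ge y\sqrt{\mathrm{Var}(X_{\alpha,\lambda})}\right)=0.$$
   Context: $\mathbf{P}$, $\mathbf{E}$ and $\mathrm{Var}$ denote probability, expectation and variance. The density is $0$ outside the indicated range. *)

(* Defs.v *)
From mathcomp Require Import all_boot all_order all_algebra.
From mathcomp Require Import all_classical all_reals all_analysis.

Set Implicit Arguments.
Unset Strict Implicit.
Unset Printing Implicit Defensive.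

Import Order.TTheory GRing.Theory Num.Theory.

Local Open Scope classical_set_scope.
Local Open Scope ring_scope.

Definition weibull_pdf (R : realType) (alpha lambda x : R) : R :=
  if 0 < x then
    alpha * lambda * x `^ (alpha - 1) * expR (- (lambda * x `^ alpha))
  else 0.

Definition has_density (R : realType) (d : measure_display)
    (T : measurableType d) (P : probability T R) (X : {RV P >-> R})
    (f : R -> R) : Prop :=
  forall A : set R, measurable A ->
    distribution P X A = (\int[lebesgue_measure]_(x in A) (f x)%:E)%E.

(* Main.v *)
Require Import Defs.
From mathcomp Require Import all_boot all_order all_algebra ring lra.
From mathcomp Require Import all_classical all_reals all_analysis.
From mathcomp Require Import measurable_realfun.

Import Order.TTheory GRing.Theory Num.Theory.
Import numFieldNormedType.Exports.

Local Open Scope classical_set_scope.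
Local Open Scope ring_scope.

(** As the shape parameter decreases to [0], the standard deviation of a
    Weibull variable becomes arbitrarily large compared with its mean. The
    event that the variable deviates by [y] standard deviations is then, up to
    a negligible correction, the event that it exceeds a huge multiple of its
    mean, and Markov's inequality makes that improbable.

    It suffices to take [lambda = 1] and [alpha = 1 / N] with [N] a positive
    integer, where the moments are factorials: [E |X|^k = (N k)!]
    ([weibull_abs_moment]). With [a = N!] and [b = (2 N)!], the inequality
    [(2 N)! >= (N + 1) N!^2] ([leq_fact_double]) gives
    [b - a^2 >= N a^2], so the standard deviation is at least
    [sqrt N] times the mean, and [deviation_le] bounds the probability by [e] once
    [y sqrt N >= 1 + 1 / e].

    The moments come from the layer-cake formula
    [E Y = int_0^oo P (Y > t) dt], so that the density is only ever integrated
    over half-lines. Integrating it gives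
    [P (|X| > t) = exp (- t^(1/N))] ([weibull_abs_tail]); hence
    [P (|X|^k > t) = exp (- t^(1/(N k)))], and everything reduces to
    [int_0^oo exp (- t^(1/m)) dt = m!] ([integral_expN_powR]). Both integrals
    are evaluated from explicit primitives. *)

(** * Limits at infinity *)

Lemma cvgy_powR (R : realType) (p : R) : 0 < p -> x `^ p @[x --> +oo] --> +oo.
Proof.
move=> p0; apply/cvgryPge => A; near=> x.
have A0 : 0 <= Num.max A 0 by rewrite le_max lexx orbT.
apply: (@le_trans _ _ (Num.max A 0)); first by rewrite le_max lexx.
rewrite -[leLHS]powRr1// -(mulVf (lt0r_neq0 p0)) powRrM.
have Mx : Num.max A 0 `^ p^-1 <= x.
  by near: x; apply: nbhs_pinfty_ge; rewrite num_real.
have x0 := le_trans (powR_ge0 _ _) Mx.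
by apply: ge0_ler_powR; rewrite ?nnegrE ?powR_ge0 ?(ltW p0).
Unshelve. all: by end_near. Qed.

(** One more term of the exponential series bounds [u^j exp (- u)] by
    [(j+1)! / u]. *)
Lemma cvgy_expN_monomial (R : realType) (j : nat) :
  expR (- u) * u ^+ j @[u --> (+oo : set_system R)] --> (0 : R).
Proof.
have lim : (j.+1)`!%:R * u^-1 @[u --> (+oo : set_system R)] --> (0 : R).
  rewrite -(mulr0 (j.+1)`!%:R); apply: cvgM; first exact: cvg_cst.
  apply/gtr0_cvgV0; last exact: cvg_id.
  by near=> x; near: x; apply: nbhs_pinfty_gt; rewrite num_real.
apply: (@squeeze_cvgr _ _ _ _ (cst 0) (fun u => (j.+1)`!%:R * u^-1)) => //;
  last exact: cvg_cst.
near=> u.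
have u0 : 0 < u by near: u; apply: nbhs_pinfty_gt; rewrite num_real.
rewrite mulr_ge0 ?expR_ge0 ?exprn_ge0 ?(ltW u0)//=.
rewrite ler_pdivlMr// -mulrA -exprSr expRN ler_pdivrMl ?expR_gt0//.
rewrite -ler_pdivrMr ?ltr0n ?fact_gt0//.
by apply: le_trans (expR_ge1Dxn j (ltW u0)); rewrite lerDr.
Unshelve. all: by end_near. Qed.

(** The regularized upper incomplete gamma function [Gamma(m, u) / (m-1)!] at an
    integer [m], in closed form; up to sign and scaling, a primitive of
    [u^(m-1) exp (- u)]. *)
Definition gamma_tail {R : realType} (m : nat) (u : R) : R :=
  expR (- u) * \sum_(j < m) (u ^+ j / j`!%:R).

Lemma gamma_tail0 (R : realType) m : gamma_tail m.+1 (0 : R) = 1.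
Proof.
rewrite /gamma_tail oppr0 expR0 mul1r big_ord_recl big1 ?addr0 ?divr1//.
by move=> i _; rewrite expr0n mul0r.
Qed.

Lemma cvgy_gamma_tail (R : realType) m :
  gamma_tail m u @[u --> (+oo : set_system R)] --> (0 : R).
Proof.
elim: m => [|m IH].
  under eq_cvg do rewrite /gamma_tail big_ord0 mulr0.
  exact: cvg_cst.
have -> : gamma_tail m.+1 =
    (fun u : R => gamma_tail m u + expR (- u) * u ^+ m * m`!%:R^-1).
  by apply/funext => u; rewrite /gamma_tail big_ord_recr/= mulrDr mulrA.
suff : (fun u : R => gamma_tail m u + expR (- u) * u ^+ m * m`!%:R^-1) u
    @[u --> +oo] --> (0 + 0 * m`!%:R^-1 : R) by rewrite mul0r addr0.
by apply: cvgD IH _; apply: cvgMl; exact: cvgy_expN_monomial.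
Qed.

(** By induction on [m]: the derivative of the term [u^m exp (- u) / m!] added
    at each step cancels the previous derivative and leaves the next one, so
    the sum telescopes. *)
Lemma is_derive_gamma_tail (R : realType) m (u : R) :
  is_derive u 1 (gamma_tail m.+1) (- (expR (- u) * u ^+ m / m`!%:R)).
Proof.
have dE : is_derive u 1 (fun u : R => expR (- u)) (- expR (- u)).
  rewrite -mulrN1; apply: (@is_derive1_comp _ expR -%R).
elim: m => [|m IH].
  rewrite [X in is_derive _ _ X](_ : _ = fun u => expR (- u)).
    by rewrite expr0 mulr1 divr1.
  apply/funext => v.
  by rewrite /gamma_tail big_ord_recl big_ord0 addr0 divr1 mulr1.
rewrite [X in is_derive _ _ X](_ : _ = gamma_tail m.+1 \+
   (fun u => m.+1`!%:R^-1 *: (expR (- u) * u ^+ m.+1)))%R.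
  have dX : is_derive u 1 (fun v : R => v ^+ m.+1) (m.+1%:R * u ^+ m).
    rewrite (_ : (fun v : R => v ^+ m.+1) = id ^+ m.+1); last first.
      by apply/funext => v; rewrite fctE.
    by apply: is_derive_eq; rewrite /GRing.scale/= mulr1.
  apply: is_derive_eq.
  rewrite /GRing.scale/= factS natrM invfM.
  have m0 : m`!%:R != 0 :> R by rewrite pnatr_eq0 -lt0n fact_gt0.
  have m1 : m.+1%:R != 0 :> R by rewrite pnatr_eq0.
  move: m1 m0; move: (m.+1%:R : R) (m`!%:R : R) => a b a0 b0.
  by field; rewrite a0 b0.
apply/funext => v; rewrite /gamma_tail big_ord_recr/= mulrDr /GRing.scale/=.
by rewrite mulrA [in X in _ = _ + X]mulrC.
Qed.

(** * The integral of a stretched exponential *)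

Lemma is_derive_expN_powR (R : realType) (p t : R) : 0 < t ->
  is_derive t 1 (fun t : R => expR (- (t `^ p)))
    (- (p * t `^ (p - 1) * expR (- (t `^ p)))).
Proof.
move=> t0; have d1 := is_derive1_powR p t0.
have d2 := is_deriveN d1.
have d3 := is_derive1_comp (is_derive_expR _) d2.
by apply: is_derive_eq d3 _; rewrite mulrN mulrC.
Qed.

Lemma within_continuous_expN_powR (R : realType) (p : R) : 0 < p ->
  {within `[0, +oo[, continuous (fun t : R => expR (- (t `^ p)))}.
Proof.
move=> p0; apply/continuous_within_itvcyP; split.
  move=> t; rewrite in_itv/= andbT => t0.
  apply: differentiable_continuous; apply/derivable1_diffP.
  by case: (is_derive_expN_powR R p t t0).
rewrite powR0 ?lt0r_neq0//.
apply: (cvg_comp (fun t => t `^ p) (fun v => expR (- v))).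
  exact: powR_cvg0.
rewrite -[X in X @ _ --> _]/(expR \o -%R).
apply: continuous_comp; last exact: continuous_expR.
exact: opp_continuous.
Qed.

(** Substituting [t = u^(m+1)] turns the integrand into
    [(m+1) u^m exp (- u) du], whose integral is [(m+1) Gamma(m+1) = (m+1)!].
    The substitution is carried out on the primitive rather than on the
    integral. *)
Lemma integral_expN_powR (R : realType) m :
  (\int[lebesgue_measure]_(t in `[0%R, +oo[) (expR (- (t `^ m.+1%:R^-1)) : R)%:E
   = (m.+1`!%:R : R)%:E)%E.
Proof.
set p : R := m.+1%:R^-1.
have p0 : 0 < p by rewrite invr_gt0 ltr0n.
pose F (t : R) : R := - m.+1`!%:R * gamma_tail m.+1 (t `^ p).
have dF (t : R) : 0 < t -> is_derive t 1 F (expR (- (t `^ p))).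
  move=> t0.
  have d1 := is_derive1_powR p t0.
  have d2 := @is_derive1_comp R _ (fun s => s `^ p) _ _ _
    (is_derive_gamma_tail R m (t `^ p)) d1.
  have d3 := is_deriveZ (- m.+1`!%:R) d2.
  apply: is_derive_eq d3 _.
  rewrite /GRing.scale/=.
  (* [u^m] against the Jacobian of [u = t^p]: the exponents [p m] and [p - 1]
     cancel because [p (m+1) = 1]. *)
  have E : t `^ p ^+ m * t `^ (p - 1) = 1.
    rewrite -powR_mulrn ?powR_ge0// -powRrM -powRD; last first.
      by rewrite (gt_eqF t0) implybT.
    rewrite (_ : p * m%:R + (p - 1) = 0) ?powRr0//.
    rewrite addrA -[X in _ + X - _]mulr1 -mulrDr natr1.
    by rewrite mulVf ?subrr// pnatr_eq0.
  rewrite factS natrM.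
  have m0 : m`!%:R != 0 :> R by rewrite pnatr_eq0 -lt0n fact_gt0.
  have m1 : m.+1%:R != 0 :> R by rewrite pnatr_eq0.
  rewrite -[RHS]mulr1 -[X in _ = _ * X]E.
  move: (expR _) (_ ^+ m) (t `^ (p - 1)) => e um tp; rewrite /p.
  move: m1 m0; move: (m.+1%:R : R) (m`!%:R : R) => a b a0 b0.
  by field; rewrite a0 b0.
have p0' : p != 0 by rewrite lt0r_neq0.
have FE : F 0 = - m.+1`!%:R by rewrite /F powR0// gamma_tail0 mulr1.
rewrite (@ge0_continuous_FTC2y _ _ F _ 0).
- by rewrite FE sub0e -EFinN opprK.
- by move=> t _; exact: expR_ge0.
- exact: within_continuous_expN_powR.
- suff : F t @[t --> +oo] --> - m.+1`!%:R * (0 : R) by rewrite mulr0.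
  apply: cvgM; first exact: cvg_cst.
  apply: (cvg_comp (fun t => t `^ p) (gamma_tail m.+1)).
    exact: cvgy_powR.
  exact: cvgy_gamma_tail.
- by move=> t /dF[].
- apply: cvgM; first exact: cvg_cst.
  apply: (cvg_comp (fun t => t `^ p) (gamma_tail m.+1)).
    exact: powR_cvg0.
  rewrite powR0//; apply: differentiable_continuous; apply/derivable1_diffP.
  by case: (is_derive_gamma_tail R m 0).
- move=> t; rewrite in_itv/= andbT => /dF d.
  by rewrite derive1E derive_val.
Qed.

Lemma measurable_EFin_within_continuous_itvcy (R : realType)
    (f : R -> R) (a : R) :
  {within `[a, +oo[, continuous f} -> measurable_fun `]a, +oo[ (EFin \o f).
Proof.
move=> cf; apply/measurable_EFinP; apply: open_continuous_measurable_fun => //.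
by move: cf => /continuous_within_itvcyP[/in_continuous_mksetP cf _].
Qed.

(** * Tails and moments of Weibull variables *)

(** The lower end is positive because for [p < 1] the density is unbounded
    at [0], while the fundamental theorem of calculus on a half-line requires
    an integrand continuous up to the end point. *)
Lemma integral_weibull_pdf_tail (R : realType) (p t : R) : 0 < p -> 0 < t ->
  (\int[lebesgue_measure]_(x in `]t, +oo[) (weibull_pdf p 1 x)%:E
   = (expR (- (t `^ p)))%:E)%E.
Proof.
move=> p0 t0; pose g x : R := p * x `^ (p - 1) * expR (- (x `^ p)).
transitivity (\int[lebesgue_measure]_(x in `]t, +oo[) (g x)%:E)%E.
  apply: eq_integral => x; rewrite inE/= in_itv/= andbT => tx.
  by rewrite /weibull_pdf (lt_trans t0 tx) mulr1 mul1r.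
have cg : {within `[t, +oo[, continuous g}.
  apply: derivable_within_continuous => x; rewrite in_itv/= andbT => tx.
  have x0 := lt_le_trans t0 tx.
  have d1 := is_derive1_powR (p - 1) x0.
  have d2 := is_derive_expN_powR R p x x0.
  have d3 := is_deriveM (is_deriveZ p d1) d2.
  by case: d3.
rewrite integral_itv_obnd_cbnd; last first.
  exact: measurable_EFin_within_continuous_itvcy.
rewrite (@ge0_continuous_FTC2y _ _ (fun x => - expR (- (x `^ p))) _ 0).
- by rewrite sub0e -EFinN opprK.
- move=> x tx; rewrite /g !mulr_ge0 ?powR_ge0 ?expR_ge0//; exact: ltW.
- exact: cg.
- rewrite -oppr0; apply: cvgN.
  apply: (cvg_comp (fun t => t `^ p) (fun v => expR (- v))).
    exact: cvgy_powR.
  exact: cvgr_expR.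
- move=> x tx; apply: derivableN.
  by case: (is_derive_expN_powR R p x (lt_trans t0 tx)).
- apply: cvgN; apply: cvg_at_right_filter.
  have [dt _] := is_derive_expN_powR R p t t0.
  have c : {for t, continuous (fun t : R => expR (- (t `^ p)))}.
    exact/differentiable_continuous/derivable1_diffP.
  exact: c.
- move=> x; rewrite in_itv/= andbT => tx.
  have d := is_deriveN (is_derive_expN_powR R p x (lt_trans t0 tx)).
  by rewrite derive1E derive_val opprK.
Qed.

(** The absolute value stands in for [X] because the density only makes [X]
    nonnegative almost surely, whereas the layer-cake formula
    [ge0_expectation_ccdf] is about everywhere nonnegative variables. *)
Lemma weibull_abs_tail (R : realType) (d : measure_display)
    (T : measurableType d) (P : probability T R) (X : {RV P >-> R}) (p t : R) :
  0 < p -> has_density X (weibull_pdf p 1) -> 0 < t ->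
  P [set w | t < `|X w|] = (expR (- (t `^ p)))%:E.
Proof.
move=> p0 dX t0.
have -> : [set w | t < `|X w|] = X @^-1` `]-oo, (- t)[ `|` X @^-1` `]t, +oo[.
  apply/seteqP; split=> w /=; rewrite !in_itv/= andbT ltr_normr (ltrNr t).
    by case/orP; [right|left].
  by case=> h; apply/orP; [right|left].
rewrite measureU//; last first.
- rewrite -preimage_setI -(preimage_set0 X); congr (_ @^-1` _).
  apply/seteqP; split=> x //=; rewrite !in_itv/= andbT => -[xt tx].
  by have := lt_trans tx xt; rewrite ltNge => /negP[]; apply/ltW; lra.
- by rewrite -[X @^-1` _]setTI; apply: measurable_funP.
- by rewrite -[X @^-1` _]setTI; apply: measurable_funP.
rewrite -[LHS]/(distribution P X `]-oo, (- t)%R[ +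
                distribution P X `]t%R, +oo[)%E.
rewrite !dX; [|exact: measurable_itv..].
rewrite integral_weibull_pdf_tail// integral0_eq ?add0e// => x.
rewrite /= in_itv/= => xt; rewrite /weibull_pdf ifF//.
by apply/negbTE; rewrite -leNgt ltW// (lt_trans xt)// oppr_lt0.
Qed.

(** The layer-cake formula, in the one case where its right-hand side is a
    factorial. *)
Lemma expectation_of_stretched_tail (R : realType) (d : measure_display)
    (T : measurableType d) (P : probability T R) (Y : T -> R) m :
  measurable_fun setT Y -> (forall w, 0 <= Y w) ->
  (forall t : R, 0 < t ->
    P [set w | t < Y w] = (expR (- (t `^ m.+1%:R^-1)))%:E) ->
  ('E_P[Y] = (m.+1`!%:R)%:E)%E.
Proof.
move=> mY Y0 tail.
pose Y' : {RV P >-> R} := mfun_Sub (mem_set mY).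
rewrite -integral_expN_powR -[Y]/(Y' : T -> R) ge0_expectation_ccdf//.
rewrite -[LHS]integral_itv_obnd_cbnd; last first.
  apply: measurable_funTS; exact: ccdf_measurable.
rewrite -[RHS]integral_itv_obnd_cbnd; last first.
  apply: measurable_EFin_within_continuous_itvcy.
  by apply: within_continuous_expN_powR; rewrite invr_gt0 ltr0n.
apply: eq_integral => t; rewrite inE/= in_itv/= andbT => /tail <-.
rewrite /ccdf /distribution/= /pushforward; congr (P _).
by apply/seteqP; split=> w /=; rewrite in_itv/= andbT.
Qed.

(** A power of a Weibull variable is Weibull again: [|X|^(k+1) > t] says
    [|X| > t^(1/(k+1))], so the two exponents multiply in the tail. *)
Lemma weibull_abs_moment (R : realType) (d : measure_display)
    (T : measurableType d) (P : probability T R) (X : {RV P >-> R}) n k :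
  has_density X (weibull_pdf n.+1%:R^-1 1) ->
  ('E_P[(fun w => `|X w| ^+ k.+1)%R] = ((n.+1 * k.+1)`!%:R)%:E)%E.
Proof.
move=> dX; rewrite -[(_ * _)%N]prednK ?muln_gt0//.
apply: expectation_of_stretched_tail.
- by apply: measurable_funX; apply: measurableT_comp.
- by move=> w; rewrite exprn_ge0.
move=> t t0; rewrite prednK ?muln_gt0// mulnC natrM invfM powRrM.
have s0 : 0 < t `^ k.+1%:R^-1 by rewrite powR_gt0.
rewrite -(weibull_abs_tail _ _ _ _ _ _ _ _ dX s0) ?invr_gt0 ?ltr0n//.
have tE (x : R) : 0 <= x -> (t < x ^+ k.+1) = (t `^ k.+1%:R^-1 < x).
  move=> x0; rewrite -(@ltr_pXn2r _ k.+1 _ (_ `^ _))// ?nnegrE ?powR_ge0//.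
  rewrite -(powR_mulrn _ (powR_ge0 _ _)) -powRrM mulVf ?pnatr_eq0//.
  by rewrite powRr1// ltW.
by congr (P _); apply/seteqP; split=> w /=; rewrite tE.
Qed.

(** * Deviations of a variable whose second moment dominates *)

Lemma measurable_superlevel (R : realType) (d : measure_display)
    (T : measurableType d) (c : R) (g : T -> R) :
  measurable_fun setT g -> measurable [set w | c <= g w].
Proof.
move=> mg; rewrite (_ : [set _ | _] = g @^-1` `[c, +oo[).
  by rewrite -[_ @^-1` _]setTI; apply: mg.
by apply/seteqP; split=> w /=; rewrite in_itv/= andbT.
Qed.

(** Since [|E X| <= a], the standard deviation is at least [sqrt (b - a^2)], and
    a deviation of at least [(1 + 1/e) a] from [E X] forces [|X| >= a / e];
    Markov's inequality for [|X|], of mean [a], bounds the probability of that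
    by [e]. *)
Lemma deviation_le (R : realType) (d : measure_display)
    (T : measurableType d) (P : probability T R) (X : {RV P >-> R})
    (a b y e : R) :
  ('E_P[(fun w => `|X w|)%R] = a%:E)%E ->
  ('E_P[(fun w => `|X w| ^+ 2)%R] = b%:E)%E ->
  0 < a -> 0 < e -> 0 <= y -> (1 + e^-1) * a <= y * Num.sqrt (b - a ^+ 2) ->
  (P [set w | (y * Num.sqrt (fine 'V_P[X]) <= `|X w - fine 'E_P[X]|)%R]
    <= e%:E)%E.
Proof.
move=> Ea Eb a0 e0 y0 yab.
have X2 : (X : T -> R) \in Lfun P 2%:E.
  rewrite inE; apply/andP; split; first by rewrite inE/=; exact: measurable_funP.
  rewrite inE/= /finite_norm unlock/=.
  rewrite poweR_lty// (_ : integral _ _ _ = b%:E) ?ltry// -Eb unlock.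
  by apply: eq_integral => w _; rewrite -powR_mulrn.
have EX2 : ('E_P[(X : T -> R) ^+ 2] = b%:E)%E.
  rewrite -Eb; congr (expectation P _); apply/funext => w.
  by rewrite real_normK ?num_real// fctE.
have X1 : (X : T -> R) \in Lfun P 1.
  by apply: Lfun_subset12 X2; rewrite fin_num_measure.
have VE := varianceE X2.
set m := fine 'E_P[X].
have mE : ('E_P[X] = m%:E)%E by rewrite fineK// expectation_fin_num.
have ma : `|m| <= a.
  have : (`|'E_P[X]| <= a%:E)%E.
    rewrite -Ea unlock; apply: le_abse_integral => //.
    by apply/measurable_EFinP; exact: measurable_funP.
  by rewrite mE lee_fin.
have V : fine 'V_P[X] = b - m ^+ 2 by rewrite VE EX2 mE.
have sub : Num.sqrt (b - a ^+ 2) <= Num.sqrt (fine 'V_P[X]).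
  rewrite V ler_wsqrtr// lerB// -real_normK ?num_real//.
  by rewrite lerXn2r ?nnegrE ?normr_ge0 ?(ltW a0).
have c0 : 0 < a / e by rewrite divr_gt0.
have mk : ((a / e)%:E * P [set w | ((a / e)%:E <= `|(X w)%:E|)%E] <= a%:E)%E.
  by rewrite -Ea; apply: (@markov _ _ _ P X id).
apply: (@le_trans _ _ (P [set w | ((a / e)%:E <= `|(X w)%:E|)%E])).
  apply: le_measure; rewrite ?inE.
  - apply: measurable_superlevel; apply: measurableT_comp => //.
    by apply: measurable_funB => //; exact: measurable_funP.
  - apply: (measurable_superlevel _ _ _ _ (Num.norm \o X)).
    exact: measurableT_comp.
  move=> w /= h; rewrite lee_fin.
  by have := ler_normB (X w) m; have := ler_wpM2l y0 sub; lra.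
rewrite -(@lee_pmul2l _ (a / e)%:E) ?lte_fin//.
by rewrite (le_trans mk)// -EFinM lee_fin divfK// lt0r_neq0.
Qed.

(** The central binomial coefficient [C(2N, N)] is at least
    [C(N + 1, N) = N + 1]. *)
Lemma leq_fact_double N : (0 < N)%N -> (N.+1 * N`! ^ 2 <= (N * 2)`!)%N.
Proof.
move=> N0; have N2 : (N.+1 <= N * 2)%N by rewrite muln2 -addnn -addn1 leq_add2l.
rewrite -(bin_fact (ltnW N2)) muln2 -addnn addnK addnn -muln2.
by rewrite -[(_ ^ 2)%N]mulnn leq_mul2r -(binSn N) leq_bin2l ?orbT.
Qed.

Theorem proposition3p7 (R : realType)
    (d : R -> R -> measure_display)
    (T : forall alpha lambda : R, measurableType (d alpha lambda))
    (P : forall alpha lambda : R, probability (T alpha lambda) R)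
    (X : forall alpha lambda : R, {RV (P alpha lambda) >-> R})
    (X_weibull : forall alpha lambda : R, 0 < alpha -> 0 < lambda ->
       has_density (X alpha lambda) (weibull_pdf alpha lambda))
    (y : R) (y_gt0 : 0 < y) :
  ereal_inf
    [set P alpha lambda
       [set w | y * Num.sqrt (fine 'V_(P alpha lambda)[X alpha lambda])
                <= `|X alpha lambda w
                     - fine 'E_(P alpha lambda)[X alpha lambda]|]
      | alpha in [set a : R | 0 < a] & lambda in [set l : R | 0 < l]]
  = 0%E.
Proof.
apply/eqP; rewrite eq_le; apply/andP; split; last first.
  by apply: le_ereal_inf_tmp => _ [alpha _ [lambda _ <-]]; exact: measure_ge0.
apply/lee_addgt0Pr => e e0; rewrite add0e.
(* With [N = n + 1], the ratio of standard deviation to mean is at least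
   [sqrt N], and [n] is chosen so that [sqrt N >= c]. *)
pose c : R := (1 + e^-1) / y.
pose n := Num.truncn (c ^+ 2).
have c0 : 0 <= c by rewrite divr_ge0 ?(ltW y_gt0)// addr_ge0// invr_ge0 ltW.
have cn : c ^+ 2 <= n.+1%:R by apply/ltW/truncnS_gt.
have p0 : 0 < n.+1%:R^-1 :> R by rewrite invr_gt0 ltr0n.
have dX := X_weibull _ _ p0 ltr01.
apply: (@le_trans _ _ (P n.+1%:R^-1 1 [set w |
    y * Num.sqrt (fine 'V_(P n.+1%:R^-1 1)[X n.+1%:R^-1 1])
      <= `|X n.+1%:R^-1 1 w - fine 'E_(P n.+1%:R^-1 1)[X n.+1%:R^-1 1]|])).
  apply: ereal_inf_lbound; exists n.+1%:R^-1 => //; exists 1 => //; exact: ltr01.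
have E1 := weibull_abs_moment _ _ _ _ _ _ 0 dX.
have E2 := weibull_abs_moment _ _ _ _ _ _ 1 dX.
rewrite muln1 in E1.
apply: deviation_le E1 E2 _ e0 (ltW y_gt0) _.
  by rewrite ltr0n fact_gt0.
set a : R := n.+1`!%:R; set b : R := _%:R.
have a0 : 0 <= a by rewrite ler0n.
have ab : (c * a) ^+ 2 <= b - a ^+ 2.
  have : n.+2%:R * a ^+ 2 <= b by rewrite -natrX -natrM ler_nat leq_fact_double.
  rewrite exprMn -[n.+2%:R]natr1 mulrDl mul1r -lerBrDr; apply: le_trans.
  by rewrite ler_wpM2r// sqr_ge0.
have : c * a <= Num.sqrt (b - a ^+ 2).
  by rewrite -(ger0_norm (mulr_ge0 c0 a0)) -sqrtr_sqr ler_wsqrtr.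
by rewrite -(ler_pM2l y_gt0) mulrA [y * c]mulrC divfK// lt0r_neq0.
Qed.
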